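(* Let $A$ be a $d\times d$ binary matrix and let $G=\langle \Sigma \mid R_A\rangle$ be the monoid determined by $A$, where $\Sigma=\{s_1,\dots,s_d\}$, and assume that $G$ has a finite representation. For $n\in\mathbb{N}$ let $$\xi_n=\#\{g\in G: |g|=n,\ g_n \text{ is the only right free generator in } g=g_1\cdots g_n\}.$$ Then the characteristic polynomial of $A$ is $$f(\lambda)=\lambda^d-\sum_{i=1}^d \xi_i\lambda^{d-i}.$$
   Context: Let $d\ge 1$, $\Sigma=\{s_1,\dots,s_d\}$ and let $A$ be a $d\times d$ matrix with entries in $\{0,1\}$. The notation $G=\langle\Sigma\mid R_A\rangle$ means that $G$ is the monoid (with identity $e$) generated by $\Sigma$ subject to the relations $s_is_j=s_i$ for all $(i,j)$ with $A(i,j)=0$, where $s_is_j=s_i$ holds in $G$ if and only if $A(i,j)=0$. The length of $g\in G$ is $|g|=\min\{j: g=g_1g_2\cdots g_j,\ g_i\in\Sigma\}$; when $|g|=n$ we write $g=g_1\cdots g_n$ for its minimal expression, call $g$ an $n$-word, and $g_i\in \Sigma$ is its $i$-th letter. A generator $s_i$ is a right free generator if $A(i,j)=1$ for all $1\le j\le d$. Finite representation: let $C=(V,E)$ be the Cayley graph of $G$, and let $F=(V_F,E_F)\subseteq C$ be the subgraph defined by: (i) $g=g_1\cdots g_n\in V_F$ if $g_n$ is the unique right free generator in $g$; (ii) if $g_1\cdots g_n\in V_F$ then $g_1\cdots g_j\in V_F$ for each $j\le n$; (iii) $(g,g')\in E_F$ if and only if $(g,g')\in E$ and $g,g'\in V_F$.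 The monoid $G$ has a finite representation if $F$ is a finite graph.
   Formalization: In the definition of F, g=g_1…g_n ranges over all expressions of g, not only minimal ones, and F must be nonempty (some generator is right free). Without these the claim fails: rows (1,0),(1,1) have f=(λ−1)^2, not λ^2−λ; rows (0,1),(1,0) have f=λ^2−1, not λ^2. *)

(* Defs.v *)
From HB Require Import structures.
From mathcomp Require Import all_boot all_order all_algebra.
From mathcomp Require Import finmap boolp classical_sets functions cardinality.

Set Implicit Arguments.
Unset Strict Implicit.
Unset Printing Implicit Defensive.

Local Open Scope classical_set_scope.
Local Open Scope group_scope.
Local Open Scope quotient_scope.

Definition binary d (A : 'M[int]_d) : Prop :=
  forall i j, A i j = 0%R \/ A i j = 1%R.

Definition right_free d (A : 'M[int]_d) (i : 'I_d) : Prop :=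
  forall j, A i j = 1%R.

(* The generator s_i is encoded by its index i : 'I_d, and an element of the
   free monoid on the generators by a sequence of indices. *)
Inductive congr d (A : 'M[int]_d) : seq 'I_d -> seq 'I_d -> Prop :=
| congr_rel i j : A i j = 0%R -> congr A [:: i; j] [:: i]
| congr_refl u : congr A u u
| congr_sym u v : congr A u v -> congr A v u
| congr_trans u v w : congr A u v -> congr A v w -> congr A u w
| congr_cat u u' v v' :
    congr A u u' -> congr A v v' -> congr A (u ++ v) (u' ++ v').

Definition congrb d (A : 'M[int]_d) (u v : seq 'I_d) : bool := `[< congr A u v >].

Section Presentation.
Variables (d : nat) (A : 'M[int]_d).

Let congrb_refl : reflexive (congrb A).
Proof. by move=> u; apply/asboolP; apply: congr_refl. Qed.

Let congrb_sym : symmetric (congrb A).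
Proof. by move=> u v; apply/asboolP/asboolP; apply: congr_sym. Qed.

Let congrb_trans : transitive (congrb A).
Proof.
by move=> v u w /asboolP uv /asboolP vw; apply/asboolP; apply: congr_trans vw.
Qed.

Canonical congr_equiv := EquivRel (congrb A) congrb_refl congrb_sym congrb_trans.

Definition presented := {eq_quot congr_equiv}%qT.

HB.instance Definition _ : EqQuotient _ congr_equiv presented :=
  EqQuotient.on presented.
HB.instance Definition _ := Choice.on presented.

Definition word_class (u : seq 'I_d) : presented := (\pi_(presented) u)%qT.

Lemma word_classE u v : word_class u = word_class v <-> congr A u v.
Proof.
split; last by move=> uv; apply/eqmodP/asboolP.
by move/eqmodP/asboolP.
Qed.

Definition presented_mul (g h : presented) : presented :=
  word_class (repr g ++ repr h).

Lemma word_class_repr (g : presented) : word_class (repr g) = g.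
Proof. exact: reprK. Qed.

Lemma word_class_cat u v :
  presented_mul (word_class u) (word_class v) = word_class (u ++ v).
Proof.
by apply/word_classE; apply: congr_cat; apply/word_classE;
   rewrite word_class_repr.
Qed.

Lemma presented_mulA : associative presented_mul.
Proof.
move=> g h k; rewrite -(word_class_repr g) -(word_class_repr h).
by rewrite -(word_class_repr k) !word_class_cat catA.
Qed.

Lemma presented_mul1 : left_id (word_class [::]) presented_mul.
Proof. by move=> g; rewrite -(word_class_repr g) word_class_cat. Qed.

Lemma presented_mulr1 : right_id (word_class [::]) presented_mul.
Proof. by move=> g; rewrite -(word_class_repr g) word_class_cat cats0. Qed.

HB.instance Definition _ := isMonoid.Build presented
  presented_mulA presented_mul1 presented_mulr1.

End Presentation.

Definition gen d (A : 'M[int]_d) (i : 'I_d) : presented A := word_class A [:: i].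

Definition expr d (A : 'M[int]_d) (w : seq 'I_d) : presented A :=
  \prod_(i <- w) gen A i.

Lemma expr_word_class d (A : 'M[int]_d) w : expr A w = word_class A w.
Proof.
rewrite /expr; elim: w => [|i w IHw]; first by rewrite big_nil.
by rewrite big_cons IHw; apply: (word_class_cat A [:: i] w).
Qed.

Lemma expr_exists d (A : 'M[int]_d) (g : presented A) :
  exists n, `[< exists w, size w = n /\ expr A w = g >].
Proof.
exists (size (repr g)); apply/asboolP; exists (repr g); split=> //.
by rewrite expr_word_class word_class_repr.
Qed.

Definition len d (A : 'M[int]_d) (g : presented A) : nat :=
  ex_minn (expr_exists g).

Definition minimal_expr d (A : 'M[int]_d) (g : presented A) (w : seq 'I_d) : Prop :=
  expr A w = g /\ size w = len g.

(* Occurrences are counted, not distinct generators: s_i s_i does not qualify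
   when s_i is right free. *)
Definition only_last_right_free d (A : 'M[int]_d) (w : seq 'I_d) : Prop :=
  exists u i, [/\ w = rcons u i, right_free A i
                & forall j, j \in u -> ~ right_free A j].

Definition cayley_edge d (A : 'M[int]_d) : set (presented A * presented A) :=
  [set e | exists i, e.2 = e.1 * gen A i].

(* g = g_1 ... g_n ranges over all expressions of g, not only minimal ones. For
   A = [[1, 0], [1, 1]] one has s_1 = s_1 s_2 with s_2 the only right free
   generator, so s_1 and all its powers are vertices. With minimal expressions
   alone this monoid would have a one-generator F, xi_1 = 1 and xi_2 = 0, whereas
   the characteristic polynomial of A is (X - 1)^2. *)
Inductive F_vertex d (A : 'M[int]_d) : presented A -> Prop :=
| F_vertex_right_free w : only_last_right_free A w -> F_vertex (expr A w)
| F_vertex_prefix u v : F_vertex (expr A (u ++ v)) -> F_vertex (expr A u).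

Arguments F_vertex [d] A g.

Definition F_edge d (A : 'M[int]_d) : set (presented A * presented A) :=
  [set e | [/\ cayley_edge e, F_vertex A e.1 & F_vertex A e.2]].

Arguments F_edge [d] A e.

(* As usual a graph has at least one vertex. This matters: when no generator is
   right free, F is empty, every xi_n is 0, and A need not be nilpotent. *)
Definition finite_graph (T : Type) (V : set T) (E : set (T * T)) : Prop :=
  [/\ V !=set0, finite_set V & finite_set E].

Definition finite_representation d (A : 'M[int]_d) : Prop :=
  finite_graph (F_vertex A) (F_edge A).

Definition xi_set d (A : 'M[int]_d) (n : nat) : set (presented A) :=
  [set g | len g = n /\
           exists2 w, minimal_expr g w & only_last_right_free A w].

Arguments xi_set [d] A n g.

Lemma finite_xi_set d (A : 'M[int]_d) n : finite_set (xi_set A n).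
Proof.
apply: (@sub_finite_set _ _ ((fun t : n.-tuple 'I_d => expr A t) @` setT)).
  by move=> g [<- [w [wg /eqP ws] _]]; exists (Tuple ws).
by apply: finite_image; apply: finite_finset.
Qed.

Definition xi d (A : 'M[int]_d) (n : nat) : nat := #|` fset_set (xi_set A n)|.

(* Main.v *)
Require Import Defs.
From mathcomp Require Import all_boot all_order all_algebra.
From mathcomp Require Import finmap boolp classical_sets cardinality.

(** Call a word admissible when A i j <> 0 for any two consecutive letters i, j.

    Because s_i s_j = s_i holds only if A i j = 0, the vanishing of A is a
    transitive relation: A i j = A j k = 0 gives s_i s_k = s_i s_j s_k = s_i.
    Transitivity resolves the only overlap i j k of the rewriting rules
    s_i s_j -> s_i, so each element of the monoid has exactly one admissible
    expression, which is also its only minimal one ([expr_inj_sorted],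
    [minimal_exprP]).  Hence xi_n counts the walks of n vertices in the graph
    of A that meet a right free vertex at the last step only.

    A row of a right free generator consists of ones.  So A = N + u v, where N
    is A with these rows replaced by 0, u is the indicator column of the right
    free generators and v is the row of ones; the walk count reads
    xi_(k+1) = v N^k u ([xiE], [size_free_words]).

    Finiteness of the representation makes N nilpotent.  Indeed the graph F has
    a vertex, so some generator r is right free; any word w without right free
    letters is then a prefix of the word w r, which makes it a vertex of F.
    As F is finite, the admissible words of this kind have bounded length, and
    a nonzero entry of N^k would exhibit one of length k
    ([nonfree_mx_nilpotent]).

    Finally, for nilpotent N of dimension d, det(X - N) = X^d and
    (X - N)^-1 = sum_k X^(-k-1) N^k, so the determinant lemma for rank one
    perturbations gives
      det(X - N - u v) = X^d (1 - v (X - N)^-1 u)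
                       = X^d - sum_(k < d) (v N^k u) X^(d-1-k),
    see [char_poly_nilpotent_add_mul]. *)

Set Implicit Arguments.
Unset Strict Implicit.
Unset Printing Implicit Defensive.
Import GRing.Theory.
Local Open Scope ring_scope.

(** * Rank one perturbations of nilpotent matrices *)

Section NilpotentPlusRankOne.
Variables (R : idomainType) (n : nat).
Implicit Types N : 'M[R]_n.+1.

(** This is X^K (X - N)^-1 when N^K = 0: a truncated geometric series that
    avoids the field of fractions. *)
Definition resolvent_poly N K : 'M[{poly R}]_n.+1 :=
  \sum_(i < K) 'X%:M ^+ (K.-1 - i) * map_mx polyC N ^+ i.

Lemma char_poly_mx_mul_resolvent N K : N ^+ K = 0 ->
  char_poly_mx N * resolvent_poly N K = ('X^K)%:M.
Proof.
move=> NK; rewrite /resolvent_poly -subrXX_comm; last exact: (comm_scalar_mx _ (map_mx polyC N)).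
by rewrite -rmorphXn -[X in _ - X]rmorphXn /= NK map_mx0 subr0.
Qed.

Lemma monic_dvd_Xn (p q : {poly R}) m :
  p \is monic -> p * q = 'X^m -> p = 'X^((size p).-1).
Proof.
move=> mp pq; have : p %| ('X - 0%:P) ^+ m.
  by rewrite subr0 -pq dvdp_mulr.
case/dvdp_exp_XsubCP=> k _; rewrite subr0 eqp_monic ?monicXn // => /eqP ->.
by rewrite size_polyXn.
Qed.

(** The determinant of X - N is a monic divisor of a power of X. *)
Lemma char_poly_nilpotent N K : N ^+ K = 0 -> char_poly N = 'X^(n.+1).
Proof.
move=> NK; have /(congr1 determinant) := char_poly_mx_mul_resolvent NK.
rewrite det_mulmx det_scalar -exprM => /(monic_dvd_Xn (char_poly_monic N)).
by rewrite -/(char_poly N) size_char_poly.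
Qed.

Lemma nilpotent_expr_dim N K : N ^+ K = 0 -> N ^+ n.+1 = 0.
Proof.
move/char_poly_nilpotent => cN; have := Cayley_Hamilton N.
by rewrite cN rmorphXn /= horner_mx_X.
Qed.

(** Both sides agree because clearing the row v of the block matrix by column
    operations turns M into its Schur complement M - u v. *)
Lemma det_sub_mul (S : comNzRingType) m (M : 'M[S]_m) (u : 'cV_m) (v : 'rV_m) :
  \det (M - u *m v) = \det (block_mx M u v 1%:M).
Proof.
have -> : block_mx M u v 1%:M =
    block_mx (M - u *m v) u 0 1%:M *m block_mx 1%:M 0 v 1%:M.
  by rewrite mulmx_block !mulmx0 !mul0mx !mulmx1 !mul1mx subrK !add0r.
by rewrite det_mulmx det_ublock det_lblock !det1 !mulr1.
Qed.

(** With M = X - N and P = X^d M^-1, multiplying the bordered matrix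
    (M u; v 1) by a block triangular one built from P makes it block
    triangular, and its determinant is then read off up to a power of X. *)
Lemma char_poly_nilpotent_add_mul N K (u : 'cV_n.+1) (v : 'rV_n.+1) :
  N ^+ K = 0 ->
  char_poly (N + u *m v) =
  'X^(n.+1) - \sum_(i < n.+1) (v *m N ^+ i *m u) 0 0 *: 'X^(n - i).
Proof.
move=> NK; have Nn := nilpotent_expr_dim NK.
pose P := resolvent_poly N n.+1; pose M := char_poly_mx N.
pose u' := map_mx polyC u; pose v' := map_mx polyC v.
have MP : M *m P = ('X^(n.+1))%:M := char_poly_mx_mul_resolvent Nn.
have detP : 'X^(n.+1) * \det P = 'X^(n.+1) ^+ n.+1.
  by rewrite -[in LHS](char_poly_nilpotent NK) -det_mulmx MP det_scalar.
have -> : char_poly (N + u *m v) = \det (block_mx M u' v' 1%:M).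
  rewrite -det_sub_mul /char_poly /char_poly_mx map_mxD map_mxM.
  by rewrite opprD addrA.
have vPu : v' *m P *m u' =
    (\sum_(i < n.+1) (v *m N ^+ i *m u) 0 0 *: 'X^(n - i))%:M.
  rewrite /P /resolvent_poly mulmx_sumr mulmx_suml raddf_sum.
  apply: eq_bigr => i _ /=.
  rewrite -rmorphXn -[map_mx polyC N ^+ i]rmorphXn /= [_%:M * _]mul_scalar_mx.
  rewrite -scalemxAr -scalemxAl -!map_mxM [X in map_mx _ X]mx11_scalar map_scalar_mx.
  by rewrite scale_scalar_mx -mul_polyC mulrC.
(* Block column operations eliminating u. *)
have /(congr1 determinant) :
    block_mx M u' v' 1%:M *m block_mx P (- (P *m u')) 0 ('X^(n.+1))%:M
    = block_mx ('X^(n.+1))%:M 0 (v' *m P) (('X^(n.+1))%:M - v' *m P *m u').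
  rewrite mulmx_block !mulmx0 !mulmxN !mulmxA MP mul1mx mul_scalar_mx mul_mx_scalar.
  by rewrite !addr0 addNr [in RHS]addrC.
rewrite det_mulmx det_ublock det_lblock vPu -raddfB /= !det_scalar expr1.
rewrite [\det P * _]mulrC detP mulrC; apply: mulfI.
by rewrite -exprM monic_neq0 ?monicXn.
Qed.
End NilpotentPlusRankOne.

(** * Normal forms in the monoid *)

Section NormalForms.
Variables (d : nat) (A : 'M[int]_d).
Implicit Types (i j : 'I_d) (u v w s : seq 'I_d).

Definition admissible i j := A i j != 0.

(** Right multiplication of a normal form by a letter.  Words are stored in
    reverse, so the head of [s] is the last letter of the normal form. *)
Definition push s j :=
  if s is i :: _ then if A i j == 0 then s else j :: s else [:: j].

Lemma expr_cat u v : expr A (u ++ v) = (expr A u * expr A v)%g.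
Proof. by rewrite /expr big_cat. Qed.

Lemma foldl_push_sorted s i w : path admissible i w ->
  foldl push (i :: s) w = catrev w (i :: s).
Proof.
elim: w i s => //= j w IHw i s /andP[/negPf Aij jw].
by rewrite Aij IHw.
Qed.

Lemma size_foldl_push s w : (size (foldl push s w) <= size s + size w)%N.
Proof.
elim: w s => [|j w IHw] s /=; first by rewrite addn0.
apply: leq_trans (IHw _) _; rewrite addnS -addSn leq_add2r.
by case: s => //= i s; case: ifP => //=.
Qed.

Lemma nonadmissible_factor w : ~~ sorted admissible w ->
  exists u i j v, w = u ++ [:: i, j & v] /\ A i j = 0.
Proof.
case: w => // i w; elim: w i => //= j w IHw i.
rewrite negb_and negbK => /orP[/eqP Aij|/IHw [u [k [l [v [-> Akl]]]]]].
  by exists [::], i, j, w.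
by exists (i :: u), k, l, v.
Qed.

Hypothesis hR : forall i j, (gen A i * gen A j)%g = gen A i <-> A i j = 0.

(** Compute s_i s_j s_k in two ways. *)
Lemma zero_trans i j k : A i j = 0 -> A j k = 0 -> A i k = 0.
Proof.
move=> /hR ij /hR jk; apply/hR.
by rewrite -{1}ij -mulgA jk.
Qed.

(** [push] defines a right action of the monoid on words.  A defining relation
    s_i s_j = s_i acts correctly: if s_i is absorbed by the last letter, so is
    s_j, by [zero_trans].  Acting on the empty word recovers an admissible word
    from its class, whence the uniqueness of normal forms. *)
Lemma foldl_push_congr u v s : congr A u v -> foldl push s u = foldl push s v.
Proof.
move=> uv; elim: uv s => {u v} //= [i j Aij|u v w _ IHu _ IHv|u u' v v' _ IHu _ IHv] s.
- case: s => [|l s] /=; first by rewrite Aij eqxx.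
  by case: eqP => /= [Ali|_]; rewrite ?(zero_trans Ali Aij) ?Aij eqxx.
- by rewrite IHu.
- by rewrite !foldl_cat IHu IHv.
Qed.

Lemma foldl_push_nil_sorted w : sorted admissible w -> foldl push [::] w = rev w.
Proof. by case: w => //= i w iw; rewrite foldl_push_sorted. Qed.

Lemma expr_inj_sorted u v : sorted admissible u -> sorted admissible v ->
  expr A u = expr A v -> u = v.
Proof.
rewrite !expr_word_class => su sv /word_classE/(foldl_push_congr [::]).
by rewrite !foldl_push_nil_sorted // => /(can_inj revK).
Qed.

Lemma len_le w : (len (expr A w) <= size w)%N.
Proof.
by rewrite /len; case: ex_minnP => m _; apply; apply/asboolP; exists w.
Qed.

(** Every expression of the class acts on the empty word with the same result,
    and an action by n letters creates at most n of them. *)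
Lemma len_sorted w : sorted admissible w -> len (expr A w) = size w.
Proof.
move=> sw; apply/eqP; rewrite eqn_leq len_le /len.
case: ex_minnP => _ /asboolP [v [<- vw]] _; move: vw.
rewrite !expr_word_class => /word_classE/(foldl_push_congr [::]).
rewrite (foldl_push_nil_sorted sw) -(size_rev w) => <-.
exact: size_foldl_push.
Qed.

(** An inadmissible word can be shortened by one of the relations. *)
Lemma minimal_exprP g w :
  minimal_expr g w <-> sorted admissible w /\ expr A w = g.
Proof.
split=> [[wg gw]|[sw <-]]; last by split; rewrite ?len_sorted.
split=> //; apply: contraT => /nonadmissible_factor[u [i [j [v [wE Aij]]]]].
have : (len g <= size (u ++ i :: v))%N.
  rewrite -wg wE; have -> : expr A (u ++ [:: i, j & v]) = expr A (u ++ i :: v).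
    rewrite !expr_cat; congr (_ * _)%g.
    by rewrite /expr !big_cons mulgA (iffRL (hR i j)).
  exact: len_le.
by rewrite -gw wE !size_cat /= !addnS ltnn.
Qed.
End NormalForms.

(** * Words whose only right free letter is the last one *)


Section FreeWords.
Variables (d : nat) (A : 'M[int]_d).
Implicit Types (i j : 'I_d) (u v w s : seq 'I_d).

Definition right_freeb i := [forall j, A i j == 1].

Lemma freeP i : reflect (right_free A i) (right_freeb i).
Proof. by apply: (iffP forallP) => fi j; apply/eqP/fi. Qed.

(** The words [p] of length [n] such that the only right free letter of
    [i :: p] is the last one and [i :: p] is admissible.  Enumerating them by
    recursion on the first step makes their number obey the recursion of a
    matrix power applied to a column. *)
Fixpoint free_tails n i : seq (seq 'I_d) :=
  if n is m.+1 then
    if right_freeb i then [::] else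
    [seq j :: p | j <- [seq j <- enum 'I_d | A i j != 0], p <- free_tails m j]
  else if right_freeb i then [:: [::]] else [::].

Lemma mem_free_tails n i p : (p \in free_tails n i) =
  [&& size p == n, path (admissible A) i p, all (predC right_freeb) (belast i p)
    & right_freeb (last i p)].
Proof.
elim: n i p => [|n IHn] i p /=.
  by case: p => [|j p]; case: ifP.
case: ifP => fi.
  by case: p => [|j p] //=; rewrite fi /= !andbF.
apply/allpairsPdep/idP => [[j [q [+ + ->]]]|].
  by rewrite mem_filter IHn => /andP[Aij _] /and4P[/eqP/= -> -> -> ->];
     rewrite eqxx /admissible Aij fi.
case: p => // j p /and4P[/= sp /andP[Aij jp] /andP[_ bp] lp].
exists j, p; rewrite mem_filter mem_enum andbT IHn.
by split=> //; apply/and4P.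
Qed.

Lemma free_tails_uniq n i : uniq (free_tails n i).
Proof.
elim: n i => [|n IHn] i /=; case: ifP => // _.
apply: allpairs_uniq_dep => [|j _|]; first by rewrite filter_uniq ?enum_uniq.
  exact: IHn.
by move=> [j p] [k q] _ _ /= [-> ->].
Qed.

Definition free_words n : seq (seq 'I_d) :=
  [seq i :: p | i <- enum 'I_d, p <- free_tails n i].

Lemma free_words_uniq n : uniq (free_words n).
Proof.
apply: allpairs_uniq_dep => [|i _|]; first exact: enum_uniq.
  exact: free_tails_uniq.
by move=> [j p] [k q] _ _ /= [-> ->].
Qed.

Lemma mem_free_words n w : w \in free_words n <->
  [/\ size w = n.+1, sorted (admissible A) w & only_last_right_free A w].
Proof.
split.
  case/allpairsPdep => i [p [_ + ->]].
  rewrite mem_free_tails => /and4P[/eqP/= -> -> /allP bp lp]; split=> //.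
  exists (belast i p), (last i p); rewrite lastI; split=> //; first exact/freeP.
  by move=> j /bp /= /freeP.
case: w => [[] //|i p [[sp] ip [u [j [ipE /freeP fj nf]]]]].
apply/allpairsPdep; exists i, p; split; rewrite ?mem_enum // mem_free_tails.
move: ipE; rewrite lastI => /rcons_inj[-> ->].
rewrite /= in ip; rewrite sp eqxx ip fj andbT /=.
by apply/allP => k /nf /freeP.
Qed.

Lemma xiE (hR : forall i j, (gen A i * gen A j)%g = gen A i <-> A i j = 0) n :
  xi A n.+1 = size (free_words n).
Proof.
rewrite -(size_map (expr A)); apply: perm_size; apply: uniq_perm.
- exact: fset_uniq.
- rewrite map_inj_in_uniq ?free_words_uniq // => u v.
  move=> /mem_free_words[_ su _] /mem_free_words[_ sv _].
  exact: expr_inj_sorted.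
move=> g; rewrite in_fset_set; last exact: finite_xi_set.
apply/idP/mapP => [/set_mem [gn [w mw ow]]|[w /mem_free_words[sw aw ow] ->]].
  exists w; last by case: mw.
  apply/mem_free_words; split=> //; last by case/(minimal_exprP hR): mw.
  by rewrite -gn; case: mw.
apply/mem_set; split; first by rewrite len_sorted.
by exists w => //; apply/(minimal_exprP hR).
Qed.

Lemma F_vertex_free g : F_vertex A g -> exists i, right_free A i.
Proof. by elim=> // w [u [i [_ fi _]]]; exists i. Qed.

(** A word [w] without right free letters is a vertex of F, since appending a
    right free generator gives an expression of the required kind.  Such a
    generator exists because F is nonempty. *)
Lemma finite_representation_bound
  (hR : forall i j, (gen A i * gen A j)%g = gen A i <-> A i j = 0) :
  finite_representation A ->
  exists K, forall w, sorted (admissible A) w -> all (predC right_freeb) w ->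
    (size w <= K)%N.
Proof.
case=> [[g /F_vertex_free[r fr]] /finite_seqP[gs Vgs] _].
exists (\max_(h <- gs) len h)%N => w sw nw.
rewrite -(len_sorted hR sw); apply: leq_bigmax_seq => //.
have : F_vertex A (expr A w).
  apply: (@F_vertex_prefix _ _ _ [:: r]); apply: F_vertex_right_free.
  exists w, r; rewrite cats1; split=> // j /(allP nw) /= nj /freeP fj.
  by rewrite fj in nj.
by rewrite Vgs.
Qed.

End FreeWords.

(** * Counting these words with powers of a matrix *)


Section NonfreeMatrix.
Variables (n : nat) (A : 'M[int]_n.+1).
Implicit Types (i j : 'I_n.+1).

Definition nonfree_mx : 'M[int]_n.+1 :=
  \matrix_(i, j) (if right_freeb A i then 0 else A i j).
Definition free_col : 'cV[int]_n.+1 := \col_i (right_freeb A i)%:R.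

Lemma mx_split : A = nonfree_mx + free_col *m const_mx 1.
Proof.
apply/matrixP=> i j; rewrite !mxE big_ord1 !mxE mulr1.
by case: freeP => [->|_]; rewrite ?add0r ?addr0.
Qed.

Lemma nonfree_mx_path k i j : (nonfree_mx ^+ k) i j != 0 ->
  exists p, [/\ size p = k, path (admissible A) i p
    & all (predC (right_freeb A)) (belast i p)].
Proof.
elim: k i j => [|k IHk] i j; first by exists [::].
rewrite exprS mxE => nz.
have [l] : exists l, nonfree_mx i l * (nonfree_mx ^+ k) l j != 0.
  by apply/existsP; apply: contra_neqT nz => /existsPn z0;
     apply: big1 => l _; apply/eqP/negbNE.
rewrite mulf_eq0 negb_or mxE; case: ifP => [|fi]; first by rewrite eqxx.
case/andP=> Ail /IHk[p [<- lp bp]].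
by exists (l :: p); split; rewrite //= ?fi ?bp ?lp ?andbT.
Qed.

Lemma size_free_tails (hA : binary A) k i :
  (size (free_tails A k i))%:R = (nonfree_mx ^+ k *m free_col) i 0.
Proof.
elim: k i => [|k IHk] i /=.
  by rewrite expr0 mul1mx mxE; case: ifP.
rewrite exprS -mulmxA mxE; case: ifP => fi.
  by rewrite big1 // => j _; rewrite mxE fi mul0r.
rewrite size_allpairs_dep sumnE big_map big_filter big_enum_cond natr_sum big_mkcond.
apply: eq_bigr => j _ /=; rewrite mxE fi -IHk.
by case: (hA i j) => ->; rewrite ?eqxx ?mul0r ?mul1r.
Qed.

Lemma size_free_words (hA : binary A) k :
  (size (free_words A k))%:R = ((const_mx 1 : 'rV_n.+1) *m nonfree_mx ^+ k *m free_col) 0 0.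
Proof.
rewrite -mulmxA mxE size_allpairs_dep sumnE big_map big_enum /= natr_sum.
by apply: eq_bigr => i _; rewrite size_free_tails // [in RHS]mxE mul1r.
Qed.

(** A nonzero entry of the power K + 1 yields an admissible word of length
    K + 1 without right free letters: the walk minus its last vertex. *)
Lemma nonfree_mx_nilpotent
  (hR : forall i j, (gen A i * gen A j)%g = gen A i <-> A i j = 0) :
  finite_representation A -> exists K, nonfree_mx ^+ K = 0.
Proof.
case/(finite_representation_bound hR) => K hK; exists K.+1.
apply/matrixP => i j; rewrite [RHS]mxE; apply/eqP; apply: contraT.
case/nonfree_mx_path => p [sp ip bp].
have := hK (belast i p); rewrite size_belast sp ltnn => -> //.
suff : sorted (admissible A) (rcons (belast i p) (last i p)).
  by rewrite -cats1 => /cat_sorted2[].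
by rewrite -lastI.
Qed.
End NonfreeMatrix.

Theorem theorem3p1 (d : nat) (A : 'M[int]_d) (hd : (1 <= d)%N) (hA : binary A)
  (hR : forall i j : 'I_d, (gen A i * gen A j)%g = gen A i <-> A i j = 0)
  (hF : finite_representation A) :
  char_poly A = 'X^d - \sum_(1 <= i < d.+1) (xi A i)%:R *: 'X^(d - i).
Proof.
case: d hd A hA hR hF => // n _ A hA hR hF.
have [K NK] := nonfree_mx_nilpotent hR hF.
rewrite [in LHS](mx_split A) (char_poly_nilpotent_add_mul _ _ NK).
rewrite big_add1 big_mkord; congr (_ - _); apply: eq_bigr => k _.
by rewrite xiE // size_free_words // subSS.
Qed.
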